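(* (In ZFC.) There exists a filter on a countably infinite set that is Menger and is not Hurewicz.
   Context: A filter on a set $D$ is a family $\mathcal{F}\subset\mathcal{P}(D)$ with $\emptyset\notin\mathcal{F}$, closed under intersections of two elements and under supersets in $D$. All filters are assumed to live on a countably infinite set $D$ and to contain all cofinite subsets of $D$. $\mathcal{P}(D)$ carries the Cantor set topology obtained by identifying it with ${}^{D}2$ via characteristic functions, and a filter has the subspace topology. A space $X$ is Menger if for every sequence $(\mathcal{U}_n)_{n<\omega}$ of open covers of $X$ there are finite $\mathcal{V}_n\subset\mathcal{U}_n$ such that $\bigcup_{n<\omega}\mathcal{V}_n$ is a cover of $X$. A space $X$ is Hurewicz if for every such sequence there are finite $\mathcal{V}_n\subset\mathcal{U}_n$ such that every $x\in X$ belongs to $\bigcup\mathcal{V}_n$ for all but finitely many $n$. *)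

(* Defs.v *)
From mathcomp Require Import all_boot all_classical.
From mathcomp Require Import topology.

Set Implicit Arguments.
Unset Strict Implicit.
Unset Printing Implicit Defensive.

Local Open Scope classical_set_scope.

Definition open_cover (X : topologicalType) (U : set_system X) : Prop :=
  U `<=` open /\ \bigcup_(A in U) A = [set: X].

Definition menger (X : topologicalType) : Prop :=
  forall U : nat -> set_system X, (forall n, open_cover (U n)) ->
  exists V : nat -> set_system X,
    (forall n, finite_set (V n) /\ V n `<=` U n) /\
    \bigcup_(A in \bigcup_n V n) A = [set: X].

Definition hurewicz (X : topologicalType) : Prop :=
  forall U : nat -> set_system X, (forall n, open_cover (U n)) ->
  exists V : nat -> set_system X,
    (forall n, finite_set (V n) /\ V n `<=` U n) /\
    (forall x : X, \forall n \near \oo, (\bigcup_(A in V n) A) x).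

Definition char_fun (D : Type) (A : set D) : prod_topology (fun _ : D => bool) :=
  fun x => x \in A.

(* A copy of the power set of D, carrying the topology that makes char_fun a
   homeomorphism onto the product of copies of the discrete space bool. *)
Definition powerset_space (D : Type) : topologicalType :=
  initial_topology (@char_fun D).

Definition filter_space (D : Type) (F : set_system D) : topologicalType :=
  set_type (F : set (powerset_space D)).

(* ProperFilter also asks for the whole set to be a member, which holds here
   since it is cofinite. *)
Definition free_filter (D : Type) (F : set_system D) : Prop :=
  ProperFilter F /\ (forall A : set D, cofinite_set A -> F A).

(* Main.v *)
Require Import Defs.
From mathcomp Require Import all_boot all_classical.
From mathcomp Require Import wochoice topology zify.

(** The filter lives on pairs of natural numbers, and it is generated by sets
    all of whose columns are cofinite.  A member B then has an element in each
    column n, and the covers asking for the height of such an element show that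
    a Hurewicz filter has a single h for which B meets column n below h n for
    almost all n ([not_hurewicz_criterion]).  So it suffices to put into the
    filter sets that escape every given h.

    For the Menger property, all the supersets of a member A form a compact
    set.  Hence finitely many sets of an open cover contain them all, and even
    contain every member that includes the part of A inside a large enough
    finite triangle.  The n-th cover has a sequence of finite parts with index m such
    that every A is served by all the parts from some index on.  The filter is
    therefore Menger once there is a single h such that every A is served, for
    some n, by the part of the n-th cover with index h n ([menger_criterion]).

    Let f_t, for t in S, be an unbounded family of functions indexed by a well
    order of the least possible length, so that families indexed by a proper
    initial segment are bounded.  By recursion this gives a scale g_t, increasing
    modulo finite and above f_t.  There are two cases.

    If no family indexed by S is dominating, the regions above the functions
    g_t + c generate the filter.  The scale is linearly ordered, so these regions
    are directed; countably many families indexed by S arise from the constants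
    c, and each of them fails to dominate some h_c; the maximum of the h_c with
    c <= n works for all of them ([filter_of_nondominating]).

    If a family indexed by S is dominating, so is the scale.  Fix a
    nonprincipal ultrafilter U, and for each t a set y_t that contains the
    interval [n, g_t n) for U-many n and is disjoint from it for infinitely many
    n ([split_blocks]).  A pair (i, j) stands for the interval
    [i, i + j]; the filter is generated by the cofinite sets and, for each t, the
    set of the intervals that meet y_t.  The
    second property of y_t makes these sets escape every h.  The first makes
    y_t, for large t, look like a final segment of the natural numbers to any
    given sequence of covers, at U-many places.  As sets in U intersect, this
    works for several t at once, and an induction on the number of the y_t proves
    the Menger property ([good_on_tuples]). *)

Set Implicit Arguments.
Unset Strict Implicit.
Unset Printing Implicit Defensive.

Local Open Scope classical_set_scope.
Local Open Scope card_scope.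

(** * The topology of a filter on pairs of natural numbers *)

Notation grid := (nat * nat)%type.

Definition trace (m : nat) (A : set grid) : set grid :=
  [set d | A d /\ d.1 + d.2 < m].

Lemma sub_trace (m m' : nat) (A : set grid) :
  m <= m' -> trace m A `<=` trace m' A.
Proof. by move=> le_m d [Ad ltd]; split=> //; exact: leq_trans ltd le_m. Qed.

Lemma open_evaluation (F : set_system grid) (d : grid) :
  open [set b : filter_space F | set_val b d].
Proof.
exists [set A : powerset_space grid | A d] => //.
exists [set f : prod_topology (fun _ : grid => bool) | f d]; last first.
  by rewrite predeqE => A; rewrite /= /char_fun; split; rewrite inE.
have -> : [set f : prod_topology (fun _ : grid => bool) | f d] =
    proj d @^-1` [set true].
  by rewrite predeqE => f; split=> fd; exact: fd.
apply: (iffLR (@continuousP _ (bool : topologicalType)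
  (fun f : prod_topology (fun _ : grid => bool) => f d)) _ _ _).
  exact: (@proj_continuous grid (fun _ => bool : topologicalType) d).
exact: discrete_open.
Qed.

(** Basic open sets constrain finitely many points.  If no trace were enough,
    members agreeing with b on larger and larger traces would converge
    to b from outside of U. *)
Lemma open_trace (F : set_system grid) (U : set (filter_space F))
    (b : filter_space F) :
  open U -> U b ->
  exists m, forall b' : filter_space F,
    trace m (set_val b') = trace m (set_val b) -> U b'.
Proof.
move=> [O [P openP PO] OU] Ub; apply: contrapT => noagree.
have /choice[s sP] : forall m, exists b' : filter_space F,
    trace m (set_val b') = trace m (set_val b) /\ ~ U b'.
  move=> m; apply: contrapT => nob'; apply: noagree; exists m => b' eqb'.
  by apply: contrapT => nUb'; apply: nob'; exists b'.
have nbP : nbhs (char_fun (set_val b)) P.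
  by apply: open_nbhs_nbhs; split=> //; move: Ub; rewrite -OU -PO.
have cvgs : (fun m => char_fun (set_val (s m)) : {ptws grid -> bool}) @ \oo -->
    (char_fun (set_val b) : {ptws grid -> bool}).
  apply/cvg_sup => d W [/= W' [[Q openQ QW'] W'b W'W]].
  exists (d.1 + d.2).+1 => // m /= ltm; apply: W'W.
  rewrite -QW' /= -[Q _]/((@^~ d @^-1` Q) _).
  move: W'b; rewrite -QW' /= /char_fun.
  suff -> : (d \in set_val (s m)) = (d \in set_val b) by [].
  have [/predeqP /(_ d) [+ +] _] := sP m.
  rewrite /trace /= => h1 h2; apply/idP/idP; rewrite !inE => hd.
    by case: h1.
  by case: h2.
have [m _ /(_ m (leqnn m)) Pm] := cvgs _ nbP.
by have [_] := sP m; apply; rewrite -OU /= -PO.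
Qed.

Lemma finite_nat_bound (X : set nat) :
  finite_set X -> exists m, forall x, X x -> x <= m.
Proof.
move=> /finite_seqP[s ->]; exists (\max_(i <- s) i) => x xs.
exact: (@leq_bigmax_seq _ s xpredT id).
Qed.

Definition upward_closed (F : set_system grid) : Prop :=
  forall A B, A `<=` B -> F A -> F B.

(** Compactness of the supersets of A.  Suppose that every pair (V, m) has a
    counterexample; the limit of these along an ultrafilter on pairs containing
    all the upper cones contains A, hence is a point of the space, and lies in
    some U of the cover.  Then so do counterexamples to pairs with U in V. *)
Lemma finite_cone_cover (F : set_system grid) (C : set_system (filter_space F))
    (A : set grid) :
  upward_closed F -> open_cover C -> F A ->
  exists V m, [/\ finite_set V, V `<=` C &
    forall b : filter_space F, trace m A `<=` set_val b ->
      exists2 U, V U & U b].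
Proof.
move=> Fup [Copen Ccover] FA; apply: contrapT => nocover.
pose ok (p : set_system (filter_space F) * nat) := finite_set p.1 /\ p.1 `<=` C.
have /choice[s sP] : forall p, exists b : filter_space F, ok p ->
    trace p.2 A `<=` set_val b /\ forall U, p.1 U -> ~ U b.
  move=> [V m]; apply: contrapT => nob; apply: nocover; exists V, m; split.
  - by apply: contrapT => nV; apply: nob; exists (exist _ A (mem_set FA)) => -[].
  - apply: contrapT => nV; apply: nob.
    by exists (exist _ A (mem_set FA)) => -[].
  - move=> b Ab; apply: contrapT => nU; apply: nob; exists b => _; split=> // U VU Ub.
    by apply: nU; exists U.
pose above q := [set p | [/\ ok p, q.1 `<=` p.1 & q.2 <= p.2]].
pose Phi := filter_from ok above.
have PhiF : ProperFilter Phi.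
  apply: filter_from_proper; last by move=> q okq; exists q; split.
  apply: filter_from_filter; first by exists (set0, 0); split.
  move=> [V m] [V' m'] [/= finV VC] [/= finV' V'C].
  exists (V `|` V', maxn m m').
    by split; [rewrite finite_setU|rewrite subUset].
  move=> p [okp /= VV' le_p]; move: VV'; rewrite subUset => -[? ?].
  by split; split=> //=; apply: leq_trans le_p; rewrite ?leq_maxl ?leq_maxr.
have [G [GU PhiG]] := ultraFilterLemma PhiF.
pose B := [set d | G [set p | set_val (s p) d]].
have AB : A `<=` B.
  move=> d Ad; apply: PhiG; exists (set0, (d.1 + d.2).+1); first by split.
  move=> p [okp _ ltp].
  by have [sAp _] := sP _ okp; apply: sAp; split.
pose b : filter_space F := exist _ B (mem_set (Fup _ _ AB FA)).
have [U CU Ub] : (\bigcup_(U in C) U) b by rewrite Ccover.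
have [m mP] := open_trace (Copen _ CU) Ub.
(* Pointwise on the grid, almost every counterexample agrees with the limit. *)
have Gagree d : G [set p | set_val (s p) d <-> B d].
  have [Gd|Gnd] := in_ultra_setVsetC [set p | set_val (s p) d] GU.
    by apply: filterS (Gd) => p /= pd; split.
  apply: filterS (Gnd) => p /= npd; split=> // Bd.
  by have [q [/= qd nqd]] := filter_ex (filterI Bd Gnd).
have Gtrace : G [set p | forall d : 'I_m * 'I_m,
    set_val (s p) (nat_of_ord d.1, nat_of_ord d.2) <->
    B (nat_of_ord d.1, nat_of_ord d.2)].
  by apply: filter_forall => d; exact: Gagree.
have GUp : G (above ([set U], 0)).
  by apply: PhiG; exists ([set U], 0) => //; split => //= _ ->.
have [p [/= eqp [okp Up _]]] := filter_ex (filterI Gtrace GUp).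
have [_ /(_ U (Up _ erefl)) []] := sP _ okp; apply: mP.
rewrite predeqE => -[i j]; split=> -[/= h ltm]; split=> //=;
  have lti : i < m by lia.
- have ltj : j < m by lia.
  by have [/(_ h)] := eqp (Ordinal lti, Ordinal ltj).
- have ltj : j < m by lia.
  by have [_ /(_ h)] := eqp (Ordinal lti, Ordinal ltj).
Qed.

(** Only finitely many sets are traces below m, so one finite V m can serve all
    the traces that have a finite subcover at all.  The bound m then depends on A
    but the choice of V does not. *)
Lemma cover_sequence (F : set_system grid) (C : set_system (filter_space F)) :
  upward_closed F -> open_cover C ->
  exists V : nat -> set_system (filter_space F),
    (forall m, finite_set (V m) /\ V m `<=` C) /\
    forall A, F A -> exists m, forall m', m <= m' ->
      forall b : filter_space F, trace m A `<=` set_val b ->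
        exists2 U, V m' U & U b.
Proof.
move=> Fup Ccover.
pose covered (W : set_system (filter_space F)) (a : set grid) :=
  forall b : filter_space F, a `<=` set_val b -> exists2 U, W U & U b.
have /choice[W WP] : forall a, exists W : set_system (filter_space F),
    [/\ finite_set W, W `<=` C &
     (exists W', [/\ finite_set W', W' `<=` C & covered W' a]) -> covered W a].
  move=> a; have [[W [fW WC cW]]|nW] :=
    pselect (exists W', [/\ finite_set W', W' `<=` C & covered W' a]).
    by exists W; split.
  by exists set0; split.
pose traces m := [set a | exists B, a = trace m B].
have fin_traces m : finite_set (traces m).
  pose of_bits (f : {ffun 'I_m * 'I_m -> bool}) : set grid :=
    [set d | d.1 + d.2 < m /\ exists x, f x /\ d = (nat_of_ord x.1, nat_of_ord x.2)].
  apply: (@sub_finite_set _ _ (range of_bits)); last exact/finite_image/finite_finset.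
  move=> _ [B ->]; exists [ffun x => (nat_of_ord x.1, nat_of_ord x.2) \in B] => //.
  rewrite predeqE => -[i j]; split=> [[/= ltm [x [+ eqx]]]|[/= Bij ltm]].
    by rewrite ffunE -eqx inE.
  split=> //=; have lti : i < m by lia.
  have ltj : j < m by lia.
  by exists (Ordinal lti, Ordinal ltj); rewrite ffunE inE.
exists (fun m => \bigcup_(a in \bigcup_(k in `I_m.+1) traces k) W a); split.
  move=> m; split.
    apply: bigcup_finite => [|a _]; last by case: (WP a).
    by apply: bigcup_finite => [|k _]; [exact: finite_II|exact: fin_traces].
  by apply: bigcup_sub => a _; case: (WP a).
move=> A FA; have [W' [m [fW' W'C cW']]] := finite_cone_cover Fup Ccover FA.
exists m => m' le_m b Ab.
have [_ _ cW] := WP (trace m A).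
have [|U WU Ub] := cW _ b Ab; first by exists W'.
exists U => //; exists (trace m A) => //.
by exists m => //; exists A.
Qed.

(** The point of this form is that no topology is left: [good n m A] stands for
    the statement that the m-th finite part of the n-th cover contains all members
    that include the trace of A below m, or below some smaller number. *)
Lemma menger_criterion (F : set_system grid) :
  upward_closed F ->
  (forall good : nat -> nat -> set grid -> Prop,
    (forall n A, F A -> exists m, good n m A) ->
    (forall n m m' A, m <= m' -> good n m A -> good n m' A) ->
    (forall n m A B, trace m A `<=` B -> good n m A -> good n m B) ->
    exists h : nat -> nat, forall A, F A -> exists n, good n (h n) A) ->
  menger (filter_space F).
Proof.
move=> Fup crit C Ccover.
have /choice[V VP] : forall n, exists V : nat -> set_system (filter_space F),
    (forall m, finite_set (V m) /\ V m `<=` C n) /\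
    forall A, F A -> exists m, forall m', m <= m' ->
      forall b : filter_space F, trace m A `<=` set_val b ->
        exists2 U, V m' U & U b.
  by move=> n; exact: cover_sequence.
pose good n m A := exists2 k, k <= m & forall m', k <= m' ->
  forall b : filter_space F, trace k A `<=` set_val b ->
    exists2 U, V n m' U & U b.
have [|||h hP] := crit good.
- by move=> n A FA; have [_ /(_ _ FA)[m mP]] := VP n; exists m, m.
- by move=> n m m' A le_m [k le_k kP]; exists k => //; exact: leq_trans le_m.
- move=> n m A B AB [k le_k kP]; exists k => // m' le_m' b Bb.
  apply: (kP _ le_m') => d Ad; apply: Bb; case: (Ad) => _ ltk.
  by split=> //; apply: AB; exact: sub_trace Ad.
exists (fun n => V n (h n)); split=> [n|]; first by have [] := VP n.
rewrite predeqE => b; split=> // _.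
have [n [k le_k kP]] := hP (set_val b) (set_valP b).
have [U VU Ub] := kP _ le_k b (fun d => @proj1 _ _).
by exists U => //; exists n.
Qed.

(** The n-th cover asks for the height of a point in column n; a finite part of
    it only allows bounded heights. *)
Lemma not_hurewicz_criterion (F : set_system grid) :
  (forall A n, F A -> exists k, A (n, k)) ->
  (forall h : nat -> nat, exists2 A, F A &
    forall N, exists2 n, N <= n & forall k, k <= h n -> ~ A (n, k)) ->
  ~ hurewicz (filter_space F).
Proof.
move=> columns escape hur.
pose C n := [set U | exists k, U = [set b : filter_space F | set_val b (n, k)]].
have [n|V [VP Vcover]] := hur C.
  split; first by move=> _ [k ->]; exact: open_evaluation.
  rewrite predeqE => b; split=> // _.
  have [k bk] := columns (set_val b) n (set_valP b).
  by exists [set b : filter_space F | set_val b (n, k)] => //; exists k.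
have /choice[h hP] : forall n, exists h, forall U, V n U ->
    exists2 k, k <= h & U = [set b : filter_space F | set_val b (n, k)].
  move=> n; have [finV VC] := VP n.
  have /choice[k kP] : forall U, exists k, V n U ->
      U = [set b : filter_space F | set_val b (n, k)].
    move=> U; have [/VC [k ->]|nVU] := pselect (V n U); first by exists k.
    by exists 0.
  have [h hP] := finite_nat_bound (finite_image k finV).
  by exists h => U VU; exists (k U); [apply: hP; exists U|exact: kP].
have [A FA hA] := escape h.
have [N _ NP] := Vcover (exist _ A (mem_set FA)).
have [n le_n nA] := hA N.
have [U VU UA] := NP n le_n.
have [k le_k eU] := hP n U VU.
by apply: (nA k le_k); move: UA; rewrite eU.
Qed.

(** * Scales of minimal length *)

Definition eventually_le (f g : nat -> nat) : Prop :=
  \forall n \near \oo, f n <= g n.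

Definition bounded_on (I : Type) (X : set I) (f : I -> nat -> nat) : Prop :=
  exists h, forall t, X t -> eventually_le (f t) h.

Definition dominating_on (I : Type) (X : set I) (f : I -> nat -> nat) : Prop :=
  forall h, exists2 t, X t & \forall n \near \oo, h n < f t n.

(** The order type of S is the cardinal usually written b: the least length of a
    family of functions that is not bounded modulo finite. *)
Definition bounding_order (I : Type) (lt : I -> I -> Prop) (S : set I) : Prop :=
  [/\ well_founded lt,
      forall s t, [\/ lt s t, s = t | lt t s],
      exists f, ~ bounded_on S f &
      forall t, S t -> forall f, bounded_on [set s | lt s t] f].

Lemma not_eventually (P : nat -> Prop) :
  ~ (\forall n \near \oo, P n) -> forall N, exists2 n, N <= n & ~ P n.
Proof.
move=> nP N; apply: contrapT => nex; apply: nP; exists N => // n le_n.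
by apply: contrapT => nPn; apply: nex; exists n.
Qed.

(** Well-order all functions.  The family of all functions is unbounded; take
    the shortest initial segment that indexes an unbounded family, or everything
    if no proper initial segment does. *)
Lemma bounding_order_exists :
  exists (I : eqType) (lt : I -> I -> Prop) (S : set I), bounding_order lt S.
Proof.
pose I : eqType := (nat -> nat : Type).
have [R Rwo] := well_ordering_principle I.
have Rmin (P : I -> Prop) : (exists x, P x) ->
    exists2 z, P z & forall x, P x -> R z x.
  move=> [x Px]; have [|z [[zP zmin] _]] := Rwo [pred x | `[< P x >]].
    by exists x; apply/asboolP.
  exists z; first exact/asboolP.
  by move=> t Pt; apply: zmin; apply/asboolP.
have Rtot s t : R s t \/ R t s.
  have [|z [->|->] zmin] := Rmin (fun x => x = s \/ x = t); first by exists s; left.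
  - by left; apply: zmin; right.
  - by right; apply: zmin; left.
have Ranti s t : R s t -> R t s -> s = t.
  move=> Rst Rts; have [|z [[zP zmin] zuniq]] := Rwo [pred x | (x == s) || (x == t)].
    by exists s; rewrite inE eqxx.
  have Rrefl x : R x x by case: (Rtot x x).
  have min_s : minimum_of R [pred x | (x == s) || (x == t)] s.
    by split=> [|x]; rewrite inE ?eqxx // => /orP[]/eqP->.
  have min_t : minimum_of R [pred x | (x == s) || (x == t)] t.
    by split=> [|x]; rewrite inE ?eqxx ?orbT // => /orP[]/eqP->.
  by rewrite -(zuniq _ min_s) -(zuniq _ min_t).
pose lt s t := R s t /\ s <> t.
have wf_lt : well_founded lt.
  move=> x; apply: contrapT => nAcc.
  have [|z nAccz zmin] := Rmin (fun x => ~ Acc lt x); first by exists x.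
  apply: nAccz; constructor=> y [Ryz neq]; apply: contrapT => nAccy.
  by apply: neq; apply: Ranti => //; apply: zmin.
have tri s t : [\/ lt s t, s = t | lt t s].
  have [->|neq] := pselect (s = t); first by constructor 2.
  case: (Rtot s t) => Rst; first by constructor 1.
  by constructor 3; split=> // eqts; apply: neq.
have [short|long] := pselect (exists t f, ~ bounded_on [set s | lt s t] f).
  have [t unb tmin] := Rmin _ short.
  exists I, lt, [set s | lt s t]; split=> // s [Rst neq] f.
  apply: contrapT => nb; apply: neq; apply: Ranti => //.
  by apply: tmin; exists f.
exists I, lt, setT; split=> //.
  exists id => -[h hP]; have [N _ /(_ N (leqnn N))] := hP (fun n => (h n).+1) Logic.I.
  by rewrite ltnn.
by move=> t _ f; apply: contrapT => nb; apply: long; exists t, f.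
Qed.

(** Recursion where the value at x is only known to exist, and the requirement
    P on it depends on the earlier values. *)
Lemma well_founded_choice (I A : Type) (a0 : A) (lt : I -> I -> Prop)
    (P : I -> (I -> A) -> A -> Prop) :
  well_founded lt ->
  (forall x g g' a, (forall y, lt y x -> g y = g' y) -> P x g a -> P x g' a) ->
  (forall x g, exists a, P x g a) ->
  exists g, forall x, P x g (g x).
Proof.
move=> wf local step.
have /choice[pick pickP] : forall p : I * (I -> A), exists a, P p.1 p.2 a.
  by move=> p; exact: step.
pose rec x (r : forall y, lt y x -> A) :=
  pick (x, fun y => if pselect (lt y x) is left yx then r y yx else a0).
pose g := Fix wf (fun=> A) rec.
exists g => x; rewrite {2}/g Fix_eq.
  apply: local (pickP (x, _)) => y yx /=.
  by case: pselect.
move=> z r r' eqr; rewrite /rec; congr (pick (_, _)).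
by apply: funext => y; case: pselect.
Qed.

(** The earlier functions are bounded by some h, because they are indexed by a
    proper initial segment; partial sums then make the next function monotone and
    keep it above everything in sight. *)
Lemma scale_exists (I : Type) (lt : I -> I -> Prop) (S : set I)
    (f : I -> nat -> nat) :
  bounding_order lt S ->
  exists g : I -> nat -> nat, forall t, S t ->
    [/\ {homo g t : m n / m <= n},
        forall n, n < g t n,
        forall n, f t n <= g t n &
        forall s, lt s t -> eventually_le (g s) (g t)].
Proof.
move=> [wf _ _ bnd].
apply: (@well_founded_choice _ _ (fun=> 0) lt
  (fun t g a => S t -> [/\ {homo a : m n / m <= n}, forall n, n < a n,
     forall n, f t n <= a n & forall s, lt s t -> eventually_le (g s) a]) wf).
  move=> t g g' a eqg Pa St; have [amono agt af ag] := Pa St.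
  by split=> // s st; rewrite -eqg //; exact: ag.
move=> t g; have [St|nSt] := pselect (S t); last by exists (fun=> 0).
have [h hP] := bnd t St g.
have le_sum n : f t n + n.+1 + h n <= \sum_(i < n.+1) (f t i + i.+1 + h i).
  by rewrite big_ord_recr /= leq_addl.
exists (fun n => \sum_(i < n.+1) (f t i + i.+1 + h i)) => _; split.
- move=> m n le_mn; rewrite -!(big_mkord xpredT (fun i => f t i + i.+1 + h i)).
  by rewrite [leqRHS](@big_cat_nat _ _ _ m.+1) //= leq_addr.
- by move=> n; have := le_sum n; lia.
- by move=> n; have := le_sum n; lia.
- move=> s /hP; apply: filterS => n le_h; have := le_sum n; lia.
Qed.

Lemma cofinite_bound (B : set grid) :
  cofinite_set B -> exists m, forall d, m <= d.1 + d.2 -> B d.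
Proof.
move=> /(finite_image (fun d => d.1 + d.2)) /finite_nat_bound[m mP].
exists m.+1 => d le_d; apply: contrapT => nBd.
have : d.1 + d.2 <= m by apply: mP; exists d.
by lia.
Qed.

(** * The case where no family of minimal length dominates *)

Definition menger_nonhurewicz_filter (F : set_system grid) : Prop :=
  [/\ free_filter F, menger (filter_space F) & ~ hurewicz (filter_space F)].

Lemma free_filter_generated (K : Type) (P : set K) (base : K -> set grid) :
  (forall i j, P i -> P j -> exists2 k, P k & base k `<=` base i `&` base j) ->
  (forall m, exists2 k, P k & forall d, base k d -> m <= d.1 + d.2) ->
  (forall k n, P k -> exists j, base k (n, j)) ->
  free_filter (filter_from P base).
Proof.
move=> directed tails columns; split; last first.
  move=> B /cofinite_bound[m mP]; have [k Pk kP] := tails m.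
  by exists k => // d /kP; exact: mP.
apply: filter_from_proper; last first.
  by move=> k Pk; have [j kj] := columns k 0 Pk; exists (0, j).
apply: filter_from_filter => //.
by have [k Pk _] := tails 0; exists k.
Qed.

Lemma upward_closed_generated (K : Type) (P : set K) (base : K -> set grid) :
  upward_closed (filter_from P base).
Proof. by move=> A B AB [k Pk kA]; exists k => //; exact: subset_trans AB. Qed.

Lemma filter_of_nondominating (I : Type) (lt : I -> I -> Prop) (S : set I) :
  bounding_order lt S -> (forall f, ~ dominating_on S f) ->
  exists F, menger_nonhurewicz_filter F.
Proof.
move=> bo nondom; have [_ tri [f unb] _] := bo.
have [g gP] := scale_exists f bo.
have [s0 Ss0] : exists s, S s.
  by apply: contrapT => nS; apply: unb; exists id => t St; case: nS; exists t.
pose P := [set k : I * nat | S k.1].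
pose base (k : I * nat) : set grid := [set d | g k.1 d.1 + k.2 <= d.2].
(* Modulo finite inequalities become true everywhere after adding a constant,
   here the sum of the finitely many values where they may fail. *)
have absorb s c c' t : eventually_le (g s) (g t) ->
    exists e, base (t, e) `<=` base (s, c) `&` base (t, c').
  move=> [N _ NP]; exists (c + c' + \sum_(i < N) g s i); rewrite /base => -[i j] /= le_j.
  split=> /=; last by lia.
  have [ltiN|leNi] := ltnP i N; last by have := NP i leNi => /=; lia.
  have : g s i <= \sum_(i < N) g s i by rewrite (bigD1 (Ordinal ltiN)) //= leq_addr.
  by move: (\sum_(_ < N) _) le_j => e; lia.
exists (filter_from P base); split.
- apply: free_filter_generated.
  + move=> [s c] [t c'] /= Ss St.
    have [_ _ _ gs] := gP s Ss; have [_ _ _ gt] := gP t St.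
    have [st|<-|ts] := tri s t.
    * have [e eP] := absorb s c c' t (gt s st); by exists (t, e).
    * exists (s, c + c') => // d; rewrite /base /= => le_d; split=> /=; lia.
    * have [e eP] := absorb t c' c s (gs t ts); exists (s, e) => //.
      by rewrite setIC.
  + move=> m; exists (s0, m) => // d; rewrite /base /=. lia.
  + by move=> [s c] n _; exists (g s n + c); rewrite /base /=.
- apply: menger_criterion; first exact: upward_closed_generated.
  move=> good goodE good_le good_sub.
  have /choice[m mP] : forall k : (I * nat) * nat, exists m,
      S k.1.1 -> good k.2 m (base k.1).
    move=> [k n]; have [Sk|nSk] := pselect (S k.1); last by exists 0.
    have [|m ?] := goodE n (base k); first by exists k.
    by exists m.
  have /choice[h hP] : forall c, exists h : nat -> nat, forall s, S s ->
      forall N, exists2 n, N <= n & m ((s, c), n) <= h n.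
    move=> c; apply: contrapT => nh; apply: (nondom (fun s n => m ((s, c), n))) => h.
    apply: contrapT => hP; apply: nh; exists h => s Ss.
    have nev : ~ \forall n \near \oo, h n < m ((s, c), n) by move=> ev; apply: hP; exists s.
    move=> N; have [n le_n nlt] := not_eventually nev N.
    by exists n => //; lia.
  exists (fun n => \max_(c < n.+1) h c n) => A [[s c] Ss sA].
  have [n le_n le_h] := hP c s Ss c; exists n.
  apply: (good_sub _ _ (base (s, c))); first by move=> d [/sA].
  apply: good_le (mP ((s, c), n) Ss); apply: (leq_trans le_h).
  have lt_n : c < n.+1 by [].
  exact: (@leq_bigmax _ (fun c : 'I_n.+1 => h c n) (Ordinal lt_n)).
- apply: not_hurewicz_criterion.
  + by move=> A n [[s c] Ss sA]; exists (g s n + c); apply: sA; rewrite /base /=.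
  + move=> h; have [s Ss nev] : exists2 s, S s & ~ eventually_le (f s) h.
      apply: contrapT => nex; apply: unb; exists h => s Ss.
      by apply: contrapT => nle; apply: nex; exists s.
    exists (base (s, 0)); first by exists (s, 0).
    move=> N; have [n le_n /negP] := not_eventually nev N; rewrite -ltnNge => lt_h.
    have [_ _ fg _] := gP s Ss.
    by exists n => // k le_k; rewrite /base /=; have := fg n; lia.
Qed.

(** * The case of a dominating scale *)

Lemma ultrafilter_mod3 (U : set_system nat) (b : nat -> nat) :
  UltraFilter U -> exists2 r, r < 3 & U [set n | b n %% 3 = r].
Proof.
move=> UU; have [U0|U0] := in_ultra_setVsetC [set n | b n %% 3 = 0] UU.
  by exists 0.
have [U1|U1] := in_ultra_setVsetC [set n | b n %% 3 = 1] UU; first by exists 1.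
exists 2 => //; apply: filterS (filterI U0 U1) => n [/= n0 n1]; lia.
Qed.

(** Cut the natural numbers into blocks such that [n, g n) always fits into two
    consecutive ones, and equals a block when n starts it.  One residue class
    mod 3 of blocks belongs to U; keep these blocks and their successors, and
    leave out the third class. *)
Lemma split_blocks (U : set_system nat) (g : nat -> nat) :
  UltraFilter U -> {homo g : m n / m <= n} -> (forall n, n < g n) ->
  exists y : set nat,
    U [set n | forall j, n <= j < g n -> y j] /\
    forall N, exists2 n, N <= n & forall j, n <= j < g n -> ~ y j.
Proof.
move=> UU gmono gt; pose a i := iter i g 0.
have a_ge i : i <= a i by elim: i => //= i IH; exact: leq_trans (gt _).
have a_mono i j : i <= j -> a i <= a j.
  move=> /subnK <-; elim: (j - i) => //= k IH.
  by apply: leq_trans IH _; exact: ltnW (gt _).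
have /choice[b bP] : forall n, exists i, a i <= n < a i.+1.
  move=> n; elim: n => [|n [i /andP[le_n lt_n]]]; first by exists 0 => /=.
  have [lt_n1|le_n1] := ltnP n.+1 (a i.+1); first by exists i; rewrite leqW.
  have -> : n.+1 = a i.+1 by apply/eqP; rewrite eqn_leq lt_n.
  by exists i.+1; rewrite leqnn; exact: gt.
have b_le j i : j < a i.+1 -> b j <= i.
  move=> lt_j; rewrite leqNgt; apply/negP => /a_mono.
  by have /andP[] := bP j; lia.
have b_ge j i : a i <= j -> i <= b j.
  move=> le_j; rewrite leqNgt; apply/negP => /a_mono.
  by have /andP[] := bP j; lia.
have [r lt_r Ur] := ultrafilter_mod3 b UU.
exists [set j | b j %% 3 != (r + 2) %% 3]; split.
  apply: filterS Ur => n /= nr j /andP[le_j lt_j].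
  have /andP[len ltn] := bP n.
  have := b_ge j (b n) (leq_trans len le_j).
  have : b j <= (b n).+1.
    by apply: b_le; apply: leq_trans lt_j _ => /=; apply: gmono; exact: ltnW ltn.
  by lia.
(* The left-out blocks are those with index congruent to r + 2. *)
move=> N; pose i := 3 * N + r + 2.
exists (a i); first by apply: leq_trans (a_ge i); rewrite /i; lia.
move=> j /andP[le_j lt_j] /=; have := b_ge j i le_j; have := b_le j i lt_j.
by rewrite /i; lia.
Qed.

(** Bounding one coordinate at a time shows that boundedness of families over X
    passes to families over tuples. *)
Lemma bounded_tuples (I : eqType) (X : set I) (k : nat) (f : seq I -> nat -> nat) :
  (forall f : I -> nat -> nat, bounded_on X f) ->
  bounded_on [set ws | size ws = k /\ forall w, w \in ws -> X w] f.
Proof.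
move=> bnd; elim: k f => [|k IH] f.
  by exists (f [::]) => ws [/size0nil-> _]; exists 0.
have /choice[h hP] : forall ws, exists h, forall w, X w ->
    eventually_le (f (w :: ws)) h.
  by move=> ws; exact: bnd.
have [h' h'P] := IH h; exists h' => -[|w ws] [] // [size_ws] Xws.
have le1 : eventually_le (f (w :: ws)) (h ws) by apply: hP; apply: Xws; rewrite mem_head.
have le2 : eventually_le (h ws) h'.
  by apply: h'P; split=> // v v_ws; apply: Xws; rewrite inE v_ws orbT.
by apply: filterS2 le1 le2 => n; exact: leq_trans.
Qed.

(** A point (i, j) is read as the interval [i, i + j].  The second component of
    p plays the role of one more set to be hit, the final segment from p.2. *)
Definition hitting (I : eqType) (y : I -> set nat) (p : seq I * nat) : set grid :=
  [set d | p.2 <= d.1 + d.2 /\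
    forall w, w \in p.1 -> exists2 j, d.1 <= j <= d.1 + d.2 & y w j].

(** Induction on the length of the tuple.  Let h work for tuples of length k,
    and let s be such that g_t is above h for all t from s on.  If a tuple of
    length k + 1 has such an entry w, then for U-many n the set y_w contains
    [n, h n), so below h n adding w to the other entries changes nothing, and h
    works for the whole tuple.  The remaining tuples have all their entries below
    s, and the functions belonging to them are bounded. *)
Lemma good_on_tuples (I : eqType) (lt : I -> I -> Prop) (S : set I)
    (U : set_system nat) (g : I -> nat -> nat) (y : I -> set nat)
    (good : nat -> nat -> set grid -> Prop) :
  bounding_order lt S -> ProperFilter U -> \oo `<=` U ->
  (forall h, exists2 s, S s &
    forall t, S t -> ~ lt t s -> eventually_le h (g t)) ->
  (forall t, S t -> U [set n | forall j, n <= j < g t n -> y t j]) ->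
  (forall n ws, (forall w, w \in ws -> S w) -> exists m, good n m (hitting y (ws, n))) ->
  (forall n m m' A, m <= m' -> good n m A -> good n m' A) ->
  (forall n m A B, trace m A `<=` B -> good n m A -> good n m B) ->
  forall k, exists h : nat -> nat, forall ws,
    size ws = k -> (forall w, w \in ws -> S w) ->
    U [set n | good n (h n) (hitting y (ws, n))].
Proof.
move=> [_ _ _ bnd] UF ooU dom yP goodE good_le good_sub.
have /choice[m mP] : forall p : seq I * nat, exists m,
    (forall w, w \in p.1 -> S w) -> good p.2 m (hitting y p).
  move=> [ws n]; have [Sws|nS] := pselect (forall w, w \in ws -> S w); last by exists 0.
  by have [m ?] := goodE n ws Sws; exists m.
elim=> [|k [h hP]].
  exists (fun n => m ([::], n)) => ws /size0nil-> _.
  by apply: filterS filterT => n _; apply: (mP ([::], n)).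
have [s Ss sP] := dom h.
have [h' h'P] := bounded_tuples k.+1 (fun ws n => m (ws, n)) (bnd s Ss).
exists (fun n => maxn (h n) (h' n)) => ws size_ws Sws.
have [[w w_ws nlt]|all_lt] := pselect (exists2 w, w \in ws & ~ lt w s); last first.
  have le_h' : eventually_le (fun n => m (ws, n)) h'.
    apply: h'P; split=> // w w_ws; apply: contrapT => nlt.
    by apply: all_lt; exists w.
  apply: filterS (ooU _ le_h') => n /= le_n.
  by apply: good_le (mP (ws, n) Sws); rewrite leq_max le_n orbT.
have Sw := Sws w w_ws.
have Urem : U [set n | good n (h n) (hitting y (rem w ws, n))].
  apply: hP; first by rewrite size_rem // size_ws.
  by move=> v /mem_rem; exact: Sws.
apply: filterS3 Urem (ooU _ (sP w Sw nlt)) (yP w Sw) => n /= good_rem le_h y_block.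
apply: (@good_le _ (h n)); first by rewrite leq_max leqnn.
apply: good_sub good_rem => d [[/= le_n hit] lt_h]; split=> // v v_ws.
have [v_rem|] := boolP (v \in rem w ws); first exact: hit.
move: v_ws; rewrite (perm_mem (perm_to_rem w_ws)) inE => /orP[/eqP-> _|->//].
(* The right end of the interval is already in the block [n, h n). *)
exists (d.1 + d.2); first by rewrite leq_addr leqnn.
by apply: y_block; rewrite le_n (leq_trans lt_h).
Qed.

Lemma filter_of_dominating (I : eqType) (lt : I -> I -> Prop) (S : set I)
    (f : I -> nat -> nat) :
  bounding_order lt S -> dominating_on S f -> exists F, menger_nonhurewicz_filter F.
Proof.
move=> bo dom; have [_ tri _ _] := bo.
have [g gP] := scale_exists f bo.
have [U [UU ooU]] := ultraFilterLemma eventually_filter.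
have /choice[y yP] : forall t, exists y : set nat, S t ->
    U [set n | forall j, n <= j < g t n -> y j] /\
    forall N, exists2 n, N <= n & forall j, n <= j < g t n -> ~ y j.
  move=> t; have [St|nSt] := pselect (S t); last by exists set0.
  have [gmono ggt _ _] := gP t St.
  by have [y ?] := split_blocks UU gmono ggt; exists y.
have yU t : S t -> U [set n | forall j, n <= j < g t n -> y t j] by move=> /yP[].
have U_tail N : U [set n | N <= n] by apply: ooU; exists N.
have g_above h : exists2 s, S s &
    forall t, S t -> ~ lt t s -> eventually_le h (g t).
  have [s Ss hs] := dom h; exists s => // t St nts.
  have [_ _ fgs _] := gP s Ss.
  have le_s : eventually_le h (g s).
    by apply: filterS hs => n lt_n; exact: leq_trans (ltnW lt_n) (fgs n).
  have [st|<-//|//] := tri s t.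
  have [_ _ _ /(_ s st) le_st] := gP t St.
  by apply: filterS2 le_s le_st => n; exact: leq_trans.
have y_inf t N : S t -> exists2 j, N <= j & y t j.
  move=> St; have [n /= [le_n yn]] := filter_ex (filterI (U_tail N) (yU t St)).
  have [_ ggt _ _] := gP t St.
  by exists n => //; apply: yn; rewrite leqnn ggt.
pose P := [set p : seq I * nat | forall w, w \in p.1 -> S w].
have columns p n : P p -> exists k, hitting y p (n, k).
  case: p => ws N; rewrite /P /hitting /=; elim: ws => [|w ws IH] Sws.
    by exists N; split=> //; lia.
  have [|k [le_N hit]] := IH; first by move=> v v_ws; apply: Sws; rewrite inE v_ws orbT.
  have [|j le_j yj] := y_inf w n; first by apply: Sws; rewrite mem_head.
  exists (k + j); split=> [|v]; first by rewrite /=; lia.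
  rewrite inE => /orP[/eqP->|/hit[i le_i yi]]; first by exists j => //=; lia.
  by exists i => //=; lia.
exists (filter_from P (hitting y)); split.
- apply: free_filter_generated => //.
  + move=> [ws N] [vs M] Sws Svs; exists (ws ++ vs, maxn N M).
      by move=> w /=; rewrite mem_cat => /orP[/Sws|/Svs].
    move=> d [/= le_d hit]; split; split=> /=; try lia.
      by move=> w w_ws; apply: hit; rewrite mem_cat w_ws.
    by move=> w w_vs; apply: hit; rewrite mem_cat w_vs orbT.
  + by move=> m; exists ([::], m) => // d [].
- apply: menger_criterion; first exact: upward_closed_generated.
  move=> good goodE good_le good_sub.
  have /choice[h hP] : forall k, exists h : nat -> nat, forall ws,
      size ws = k -> (forall w, w \in ws -> S w) ->
      U [set n | good n (h n) (hitting y (ws, n))].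
    apply: (good_on_tuples bo _ ooU g_above yU) => // n ws Sws.
    by apply: goodE; exists (ws, n).
  exists (fun n => \max_(k < n.+1) h k n) => A [[ws N] Sws wsA].
  have [n [[/= le_N le_k] good_n]] := filter_ex (filterI
    (filterI (U_tail N) (U_tail (size ws))) (hP (size ws) ws erefl Sws)).
  exists n; apply: (good_sub _ _ (hitting y (ws, n))).
    by move=> d [[/= le_d hit] _]; apply: wsA; split=> //=; exact: leq_trans le_d.
  apply: good_le good_n.
  have lt_k : size ws < n.+1 by [].
  exact: (@leq_bigmax _ (fun k : 'I_n.+1 => h k n) (Ordinal lt_k)).
- apply: not_hurewicz_criterion.
  + by move=> A n [p Pp pA]; have [k pk] := columns p n Pp; exists k; exact: pA.
  + move=> h; have [s Ss [N0 _ hs]] := dom (fun n => n + h n).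
    exists (hitting y ([:: s], 0)).
      by exists ([:: s], 0) => // w; rewrite inE => /eqP->.
    move=> N; have [_ hole] := yP s Ss.
    have [n le_n ny] := hole (maxn N N0).
    exists n => [|k le_k [_ /(_ s)]]; first by lia.
    rewrite mem_head => /(_ erefl)[j /= le_j yj]; apply: (ny j) yj.
    have [_ _ fg _] := gP s Ss.
    have lt_f : n + h n < f s n by apply: hs => /=; lia.
    by have := fg n; lia.
Qed.

Theorem corollary3p7 :
  exists (D : Type) (F : set_system D),
    [set: D] #= [set: nat] /\ free_filter F /\
    menger (filter_space F) /\ ~ hurewicz (filter_space F).
Proof.
have [I [lt [S bo]]] := bounding_order_exists.
have [F [Ffree Fmenger Fnhur]] : exists F, menger_nonhurewicz_filter F.
  have [[f dom]|nondom] := pselect (exists f, dominating_on S f).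
    exact: filter_of_dominating bo dom.
  apply: (filter_of_nondominating bo) => f dom.
  by apply: nondom; exists f.
by exists grid, F; split; [exact: card_nat2|].
Qed.
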